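(* Let $G,H$ be graphs of the system GET4 and $X,Y$ formulas of the system GT4. Let $(\_)''$ and $[\_]'$ be the translations given in the context. Then: (a) $G\in TGET4$ if and only if $G''\in TT4$. (b) $X'\in TGET4$ if and only if $X\in TT4$. (c) $G\gg H$ in GET4 if and only if $H''$ is a consequence of $G''$ in GT4. (d) $X'\gg Y'$ in GET4 if and only if $Y$ is a consequence of $X$ in GT4.
   Context: Formulas. $FA$ is a set of atomic formulas. $FT$ is the smallest set containing $FA$ and the constant $\lambda$, and closed under the unary connective $-$ (weak negation) and the binary connective $\supset$. Abbreviations: $\sim X:=X\supset-\lambda$; $+X:=\sim-X$; $\otimes X:=-\sim X$; $X\cup Y:=\sim X\supset Y$; $X\cap Y:=\sim(X\supset\sim Y)$. The formulas of GT4 are those of $FT$. System GT. Axioms (for all $X,Y,Z\in FT$): Ax1 $\lambda$; Ax2 $X\supset(Y\supset X)$; Ax3 $[X\supset(Y\supset Z)]\supset[(X\supset Y)\supset(X\supset Z)]$; Ax4 $[(X\supset Y)\supset X]\supset X$; Ax5 $-\lambda\supset Z$; Ax6 $(X\supset-\lambda)\supset-X$; Ax7 $[-(X\supset Y)\supset-\lambda]\supset[(-X\supset-\lambda)\supset(-Y\supset-\lambda)]$; Ax+: if $X$ is an instance of one of Ax1,…,Ax7, then $-X\supset-\lambda$ is an axiom. The only rule is modus ponens Mp. GT4 is GT with the added axiom schema $+X\supset[-(+X\cap Y)\supset-Y]$. $X\in TT4$ means $X$ is derivable from the axioms of GT4 by Mp; $Y$ is a consequence of $X$ in GT4 if $Y$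 is derivable by Mp from the axioms of GT4 together with the assumption $X$. Graphs. $GA=FA$ is the set of atomic graphs. Graphs (the same for GET and GET4) are built from atomic graphs and the blank sheet of assertion $\lambda$ by juxtaposition $XY$ (in the same region), continuous cut $(X)$, and broken cut $\{X\}$. As $\lambda$ is blank, it may be inserted or deleted anywhere. $*X:=(\{X\})$. A region is even (odd) if it is surrounded by an even (odd) number of cuts, continuous or broken. Transformation rules of GET (applied to parts of a graph located in the indicated region). R1: $(\{\lambda\})$ may be written on the sheet of assertion. R2: in an even region, $XY\Rightarrow X$; in an odd region, $X\Rightarrow XY$. R3: $Y(X)\Leftrightarrow Y(XY)$ in a region surrounded only by (zero or more) continuous cuts; $X\Leftrightarrow XX$; $*Y(X)\Leftrightarrow *Y(X*Y)$ in a region surrounded by at least one broken cut. Here R3 allows iteration and de-iteration in any such region, even or odd. R4: in an even region, $(X)\Rightarrow\{X\}$; in an odd region, $\{X\}\Rightarrow(X)$. R6: in an even region, $((X))\Rightarrow X$; in an odd region, $X\Rightarrow((X))$. R7: two graphs in the same region may be juxtaposed, and juxtaposed graphs may be separated. R8: $XY\Leftrightarrow YX$ in any region. R9: juxtaposition is associative in any region. GET4 is GET with the added rule strong I-D: a strong graph $*Y$ may be iterated into, and de-iterated from, a region nested inside cuts at least one of which is broken, i.e. $*Y[X]\Leftrightarrow *Y[*Y\,X]$, where $[\,\cdot\,]$ denotes such a nested region, even or odd (in particular $*Y\{X\}\Leftrightarrow *Y\{*Y\,X\}$). $X\gg Y$ in GET4 means $Y$ is obtained from $X$ by finitely many applications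 of these rules; $X\in TGET4$ means $\lambda\gg X$ in GET4. Translations. For $[\_]'$ the connectives $\cap,\cup,\sim$ are treated as connectives in their own right: $P'=P$ for $P\in FA$; $\lambda'=\lambda$; $[X\supset Y]'=(X'(Y'))$; $[X\cup Y]'=((X')(Y'))$; $[-X]'=\{X'\}$; $[X\cap Y]'=X'Y'$; $[\sim X]'=(X')$. Conversely: $P''=P$; $\lambda''=\lambda$; $(X(Y))''=X''\supset Y''$; $((X)(Y))''=X''\cup Y''$; $\{X\}''=-X''$; $(XY)''=X''\cap Y''$ (juxtaposition); and $(X)''=\sim X''$ for a single continuous cut.
   Formalization: Ax+ is applied to all axioms of GT4, including the added schema, not only Ax1–Ax7; and R3 lets any graph Y be iterated, in any region, across continuous cuts only, instead of requiring Y(X) itself to lie outside all broken cuts. As literally stated, (b) fails. *)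

(* Defs.v *)
From Stdlib Require Import Arith Relations.

Set Implicit Arguments.
Unset Strict Implicit.
Unset Printing Implicit Defensive.

(** * The propositional system GT4 *)

Inductive formula (FA : Type) : Type :=
| FAtom (p : FA)
| FLam
| FNeg (X : formula FA)
| FImp (X Y : formula FA).

Arguments FLam {FA}.

Declare Scope gt_scope.
Delimit Scope gt_scope with gt.
Bind Scope gt_scope with formula.

Notation "- X" := (FNeg X) : gt_scope.
Notation "X ⊃ Y" := (FImp X Y) (at level 60, right associativity) : gt_scope.
Notation "'λ'" := FLam : gt_scope.

Section Abbreviations.
Context {FA : Type}.
Implicit Types X Y : formula FA.
Local Open Scope gt_scope.

Definition FSim X : formula FA := X ⊃ - λ.
Definition FPlus X : formula FA := FSim (- X).
Definition FCup X Y : formula FA := FSim X ⊃ Y.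
Definition FCap X Y : formula FA := FSim (X ⊃ FSim Y).

End Abbreviations.

Section Deduction.
Context {FA : Type}.
Implicit Types X Y Z : formula FA.
Local Open Scope gt_scope.

Inductive gt_schema : formula FA -> Prop :=
| Ax1 : gt_schema λ
| Ax2 X Y : gt_schema (X ⊃ (Y ⊃ X))
| Ax3 X Y Z : gt_schema ((X ⊃ (Y ⊃ Z)) ⊃ ((X ⊃ Y) ⊃ (X ⊃ Z)))
| Ax4 X Y : gt_schema (((X ⊃ Y) ⊃ X) ⊃ X)
| Ax5 Z : gt_schema (- λ ⊃ Z)
| Ax6 X : gt_schema ((X ⊃ - λ) ⊃ - X)
| Ax7 X Y :
    gt_schema ((- (X ⊃ Y) ⊃ - λ) ⊃ ((- X ⊃ - λ) ⊃ (- Y ⊃ - λ))).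

Inductive gt4_schema : formula FA -> Prop :=
| gt4_of_gt X : gt_schema X -> gt4_schema X
| Ax_strong X Y :
    gt4_schema (FPlus X ⊃ (- (FCap (FPlus X) Y) ⊃ - Y)).

(** [AxPlus] ranges over every schema of GT4, including the one added to GT.
    Confined to [gt_schema] it would leave [+(+P ⊃ ++P)] underivable, whereas
    strong iteration inside a broken cut derives the corresponding graph from
    the blank sheet. *)
Inductive gt4_axiom : formula FA -> Prop :=
| AxBase X : gt4_schema X -> gt4_axiom X
| AxPlus X : gt4_schema X -> gt4_axiom (- X ⊃ - λ).

Inductive gt4_derivable (Gamma : formula FA -> Prop) : formula FA -> Prop :=
| d_hyp X : Gamma X -> gt4_derivable Gamma X
| d_ax X : gt4_axiom X -> gt4_derivable Gamma X
| d_mp X Y :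
    gt4_derivable Gamma (X ⊃ Y) -> gt4_derivable Gamma X ->
    gt4_derivable Gamma Y.

Definition TT4 X : Prop := gt4_derivable (fun _ => False) X.

(** [gt4_consequence X Y]: [Y] is a consequence of [X]. *)
Definition gt4_consequence X Y : Prop := gt4_derivable (fun Z => Z = X) Y.

End Deduction.

(** * Graphs *)

(** A graph is a term for the marks scribed on the sheet; the blank is a term,
    so writing or deleting it is a transformation ([R_blank] below). *)
Inductive graph (GA : Type) : Type :=
| GAtom (p : GA)
| GBlank
| GJuxt (X Y : graph GA)
| GCut (X : graph GA)
| GBroken (X : graph GA).

Arguments GBlank {GA}.

Definition GStrong {GA : Type} (X : graph GA) : graph GA := GCut (GBroken X).

(** A graph with one hole; the hole stands for a region. *)
Inductive region (GA : Type) : Type :=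
| RHere
| RJuxtL (C : region GA) (Y : graph GA)
| RJuxtR (X : graph GA) (C : region GA)
| RCut (C : region GA)
| RBroken (C : region GA).

Arguments RHere {GA}.

Section Regions.
Context {GA : Type}.

Fixpoint fill (C : region GA) (X : graph GA) : graph GA :=
  match C with
  | RHere => X
  | RJuxtL C' Y => GJuxt (fill C' X) Y
  | RJuxtR Y C' => GJuxt Y (fill C' X)
  | RCut C' => GCut (fill C' X)
  | RBroken C' => GBroken (fill C' X)
  end.

(** Number of cuts of either kind around the hole. *)
Fixpoint cuts (C : region GA) : nat :=
  match C with
  | RHere => 0
  | RJuxtL C' _ | RJuxtR _ C' => cuts C'
  | RCut C' | RBroken C' => S (cuts C')
  end.

Fixpoint broken_cuts (C : region GA) : nat :=
  match C with
  | RHere => 0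
  | RJuxtL C' _ | RJuxtR _ C' => broken_cuts C'
  | RCut C' => broken_cuts C'
  | RBroken C' => S (broken_cuts C')
  end.

Definition even_region (C : region GA) : Prop := Nat.Even (cuts C).
Definition odd_region (C : region GA) : Prop := Nat.Odd (cuts C).

End Regions.

Section Transformations.
Context {GA : Type}.
Implicit Types (C D : region GA) (X Y Z : graph GA).

(** Rules that may be used in both directions, at the region [C]. *)
Inductive get_equiv C : graph GA -> graph GA -> Prop :=
(** [D] is the region, relative to the place of [Y], that [Y] is iterated
    into: an arbitrary graph may cross continuous cuts but no broken one.
    [D = RCut RHere] gives [Y(X) <=> Y(XY)]. If instead [C] had to lie outside
    all broken cuts, the graph of [+(P ⊃ P)] would not be derivable from the
    blank sheet. *)
| R3_iter D X Y :
    broken_cuts D = 0 ->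
    get_equiv C (GJuxt Y (fill D X)) (GJuxt Y (fill D (GJuxt X Y)))
| R3_dup X :
    get_equiv C X (GJuxt X X)
| R3_strong X Y :
    0 < broken_cuts C ->
    get_equiv C (GJuxt (GStrong Y) (GCut X))
                (GJuxt (GStrong Y) (GCut (GJuxt X (GStrong Y))))
| R8 X Y :
    get_equiv C (GJuxt X Y) (GJuxt Y X)
| R9 X Y Z :
    get_equiv C (GJuxt (GJuxt X Y) Z) (GJuxt X (GJuxt Y Z))
| R_blank X :
    get_equiv C (GJuxt GBlank X) X.

(** R7 has no clause: the graphs scribed in one region are represented by
    their juxtaposition. *)
Inductive get_rule C : graph GA -> graph GA -> Prop :=
| R1 :
    cuts C = 0 -> get_rule C GBlank (GStrong GBlank)
| R2_even X Y :
    even_region C -> get_rule C (GJuxt X Y) X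
| R2_odd X Y :
    odd_region C -> get_rule C X (GJuxt X Y)
| R4_even X :
    even_region C -> get_rule C (GCut X) (GBroken X)
| R4_odd X :
    odd_region C -> get_rule C (GBroken X) (GCut X)
| R6_even X :
    even_region C -> get_rule C (GCut (GCut X)) X
| R6_odd X :
    odd_region C -> get_rule C X (GCut (GCut X))
| R_equiv X Y :
    get_equiv C X Y -> get_rule C X Y
| R_equiv_sym X Y :
    get_equiv C X Y -> get_rule C Y X.

Inductive get4_rule C : graph GA -> graph GA -> Prop :=
| get4_of_get X Y :
    get_rule C X Y -> get4_rule C X Y
| strong_iter D X Y :
    0 < broken_cuts D ->
    get4_rule C (GJuxt (GStrong Y) (fill D X))
                (GJuxt (GStrong Y) (fill D (GJuxt (GStrong Y) X)))
| strong_deiter D X Y :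
    0 < broken_cuts D ->
    get4_rule C (GJuxt (GStrong Y) (fill D (GJuxt (GStrong Y) X)))
                (GJuxt (GStrong Y) (fill D X)).

Inductive get4_step : graph GA -> graph GA -> Prop :=
| get4_at C X Y : get4_rule C X Y -> get4_step (fill C X) (fill C Y).

(** [get4_gives X Y] is [X ≫ Y] in GET4. *)
Definition get4_gives : graph GA -> graph GA -> Prop :=
  clos_refl_trans (graph GA) get4_step.

Definition TGET4 X : Prop := get4_gives GBlank X.

End Transformations.

(** * Translations *)

(** Formulas as they are written, with [∩], [∪] and [∼] as connectives: the
    translation into graphs depends on the writing, since [∼X] becomes [(X')]
    but [X ⊃ -λ] becomes [(X'({λ}))]. *)
Inductive wformula (FA : Type) : Type :=
| WAtom (p : FA)
| WLam
| WNeg (X : wformula FA)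
| WImp (X Y : wformula FA)
| WSim (X : wformula FA)
| WCap (X Y : wformula FA)
| WCup (X Y : wformula FA).

Arguments WLam {FA}.

(** The formula of GT4 that a written formula abbreviates. *)
Fixpoint unabbreviate {FA : Type} (X : wformula FA) : formula FA :=
  match X with
  | WAtom p => FAtom p
  | WLam => FLam
  | WNeg X => FNeg (unabbreviate X)
  | WImp X Y => FImp (unabbreviate X) (unabbreviate Y)
  | WSim X => FSim (unabbreviate X)
  | WCap X Y => FCap (unabbreviate X) (unabbreviate Y)
  | WCup X Y => FCup (unabbreviate X) (unabbreviate Y)
  end.

(** [[X]'] *)
Fixpoint to_graph {FA : Type} (X : wformula FA) : graph FA :=
  match X with
  | WAtom p => GAtom p
  | WLam => GBlank
  | WNeg X => GBroken (to_graph X)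
  | WImp X Y => GCut (GJuxt (to_graph X) (GCut (to_graph Y)))
  | WSim X => GCut (to_graph X)
  | WCap X Y => GJuxt (to_graph X) (to_graph Y)
  | WCup X Y => GCut (GJuxt (GCut (to_graph X)) (GCut (to_graph Y)))
  end.

(** [(G)'']. The clauses overlap on continuous cuts; the most specific one
    applies. *)
Fixpoint to_formula {FA : Type} (G : graph FA) : formula FA :=
  match G with
  | GAtom p => FAtom p
  | GBlank => FLam
  | GCut (GJuxt (GCut X) (GCut Y)) => FCup (to_formula X) (to_formula Y)
  | GCut (GJuxt X (GCut Y)) => FImp (to_formula X) (to_formula Y)
  | GCut X => FSim (to_formula X)
  | GBroken X => FNeg (to_formula X)
  | GJuxt X Y => FCap (to_formula X) (to_formula Y)
  end.

(* Main.v *)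
From Stdlib Require Import Arith Relations List.
From Stdlib Require Import RelationClasses Morphisms Setoid.
Require Import Defs.
Import ListNotations.

(** GT4 is the modal logic S4 in disguise. By [Ax2]-[Ax5] the pair [⊃], [-λ]
    is classical, so [∼] is classical negation; [+X] behaves as necessity of
    [X], hence [-X] as the negation of the necessity of [X]. In the same way a
    continuous cut is classical negation, a broken cut negates necessity, and
    [({Y})] is the necessity of [Y]. Parts (a), (b) and (d) all reduce to (c),
    read for a translation [plain] that sends each continuous cut to [∼] and
    each juxtaposition to [∩]: the two translations of the statement differ
    from it by provable equivalences that remain provable inside any context
    ([to_formula_plain], [unabbreviate_plain]), and the blank sheet is [λ].

    Soundness ([gives_sound]): filling a region is monotone or antitone
    according to its parity ([fill_mono]). Crossing a broken cut requires that
    theorems be closed under [+] ([necessitation]). Iterating [Y] into a region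
    is the same statement about the consequences of [Y] instead of the
    theorems; these are closed under [+] as soon as [+Y] is one of them, which
    is why an arbitrary graph crosses continuous cuts only and a strong graph
    crosses broken ones too ([iteration_sound]).

    Completeness ([gives_complete]): [X] is said to entail [Y] when [X] may be
    turned into [Y] in every even region and [Y] into [X] in every odd one.
    Under this preorder juxtaposition is a meet, [(X(Y))] is the relative
    pseudo-complement of [X] and [Y] ([scroll_intro], [scroll_elim]) and the
    double cut collapses, so the graphs form a Boolean algebra on which the
    broken cut acts as required by the remaining axioms. The axioms are then
    entailed by the blank and modus ponens preserves entailment. All of this
    rests on [strong_blank]: although the rules write [({λ})] on the sheet only,
    it may be written and erased in every region. *)

Local Open Scope gt_scope.

(** * Propositional reasoning in GT4 *)

(** Besides the theorems, this covers the consequences of a formula and the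
    formulas [X] for which [+X] is derivable; the propositional lemmas below are
    needed for all three. *)
Definition theory {FA : Type} (T : formula FA -> Prop) : Prop :=
  (forall X, gt_schema X -> T X) /\
  (forall X Y, T (X ⊃ Y) -> T X -> T Y).

(** The sequent with antecedent [L], coded as an iterated implication whose
    most recent hypothesis is innermost, so that discharging a hypothesis is a
    conversion. *)
Fixpoint under {FA : Type} (L : list (formula FA)) (X : formula FA) :
  formula FA :=
  match L with
  | [] => X
  | A :: L => under L (A ⊃ X)
  end.

Section NaturalDeduction.
Context {FA : Type} {T : formula FA -> Prop} (HT : theory T).
Implicit Types (X Y Z : formula FA) (L : list (formula FA)).

Lemma under_theorem L X : T X -> T (under L X).
Proof.
revert X; induction L as [|A L IH]; intros X HX; simpl; [exact HX|].
apply IH, (proj2 HT X); [apply (proj1 HT), Ax2 | exact HX].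
Qed.

Lemma under_mp L X Y : T (under L (X ⊃ Y)) -> T (under L X) -> T (under L Y).
Proof.
revert X Y; induction L as [|A L IH]; simpl; intros X Y HXY HX.
- exact (proj2 HT X Y HXY HX).
- apply (IH (A ⊃ X)); [|exact HX].
  apply (IH (A ⊃ X ⊃ Y)); [|exact HXY].
  apply under_theorem, (proj1 HT), Ax3.
Qed.

Lemma under_weaken L A X : T (under L X) -> T (under (A :: L) X).
Proof.
intros H; apply (under_mp L X (A ⊃ X)); [|exact H].
apply under_theorem, (proj1 HT), Ax2.
Qed.

Lemma under_hyp L X : In X L -> T (under L X).
Proof.
induction L as [|A L IH]; simpl; [tauto|].
intros [->|HX]; [|exact (under_weaken L A X (IH HX))].
apply under_theorem, (proj2 HT (X ⊃ X ⊃ X)); [|apply (proj1 HT), Ax2].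
apply (proj2 HT (X ⊃ (X ⊃ X) ⊃ X)); apply (proj1 HT); [apply Ax3 | apply Ax2].
Qed.

Lemma under_absurd L X : T (under L (- λ)) -> T (under L X).
Proof.
apply (under_mp L (- λ)), under_theorem, (proj1 HT), Ax5.
Qed.

(** Peirce's law with consequent [-λ]. *)
Lemma under_contradiction L X : T (under (FSim X :: L) X) -> T (under L X).
Proof.
apply (under_mp L (FSim X ⊃ X)), under_theorem, (proj1 HT), Ax4.
Qed.

Lemma under_cap L X Y :
  T (under L X) -> T (under L Y) -> T (under L (FCap X Y)).
Proof.
intros HX HY; change (T (under ((X ⊃ FSim Y) :: L) (- λ))).
apply (under_mp _ Y); [|now apply under_weaken].
apply (under_mp _ X); [|now apply under_weaken].
apply under_hyp; simpl; tauto.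
Qed.

Lemma under_cap_left L X Y : T (under L (FCap X Y)) -> T (under L X).
Proof.
intros H; apply under_contradiction, under_absurd.
apply (under_mp _ (X ⊃ FSim Y)); [now apply under_weaken|].
change (T (under (X :: FSim X :: L) (FSim Y))).
apply under_absurd, (under_mp _ X); apply under_hyp; simpl; tauto.
Qed.

Lemma under_cap_right L X Y : T (under L (FCap X Y)) -> T (under L Y).
Proof.
intros H; apply under_contradiction, under_absurd.
apply (under_mp _ (X ⊃ FSim Y)); [now apply under_weaken|].
change (T (under (X :: FSim Y :: L) (FSim Y))).
apply under_hyp; simpl; tauto.
Qed.

End NaturalDeduction.

Ltac discharge :=
  match goal with
  | |- ?T (under ?L (?A ⊃ ?X)) => change (T (under (A :: L) X))
  | |- ?T (under ?L (FSim ?A)) => change (T (under (A :: L) (FNeg FLam)))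
  | |- ?T (under _ _) => fail 1
  | |- ?T ?X => change (T (under [] X))
  end.

Ltac hyp HT := apply (under_hyp HT); simpl; tauto.

Section Order.
Context {FA : Type} {T : formula FA -> Prop} (HT : theory T).
Implicit Types X Y Z : formula FA.

Lemma imp_refl X : T (X ⊃ X).
Proof. repeat discharge; hyp HT. Qed.

Lemma imp_trans X Y Z : T (X ⊃ Y) -> T (Y ⊃ Z) -> T (X ⊃ Z).
Proof.
intros H1 H2; repeat discharge.
apply (under_mp HT _ Y); [now apply under_theorem|].
exact H1.
Qed.

Lemma imp_of_theorem X Y : T Y -> T (X ⊃ Y).
Proof. exact (under_theorem HT [X] Y). Qed.

Lemma imp_cap X Y Z : T (Z ⊃ X) -> T (Z ⊃ Y) -> T (Z ⊃ FCap X Y).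
Proof. exact (under_cap HT [Z] X Y). Qed.

Lemma cap_left X Y : T (FCap X Y ⊃ X).
Proof. apply (under_cap_left HT [FCap X Y] X Y); hyp HT. Qed.

Lemma cap_right X Y : T (FCap X Y ⊃ Y).
Proof. apply (under_cap_right HT [FCap X Y] X Y); hyp HT. Qed.

Lemma cap_mono X X' Y Y' :
  T (X ⊃ X') -> T (Y ⊃ Y') -> T (FCap X Y ⊃ FCap X' Y').
Proof.
intros HX HY; apply imp_cap.
- exact (imp_trans _ _ _ (cap_left X Y) HX).
- exact (imp_trans _ _ _ (cap_right X Y) HY).
Qed.

Lemma imp_mono X X' Y Y' :
  T (X' ⊃ X) -> T (Y ⊃ Y') -> T ((X ⊃ Y) ⊃ (X' ⊃ Y')).
Proof.
intros HX HY; repeat discharge.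
apply (under_mp HT _ Y); [now apply under_theorem|].
apply (under_mp HT _ X); [hyp HT|].
apply (under_mp HT _ X'); [now apply under_theorem | hyp HT].
Qed.

Lemma sim_anti X Y : T (X ⊃ Y) -> T (FSim Y ⊃ FSim X).
Proof. intros H; exact (imp_mono _ _ _ _ H (imp_refl _)). Qed.

Lemma sim_sim_elim X : T (FSim (FSim X) ⊃ X).
Proof.
repeat discharge; apply (under_contradiction HT), (under_absurd HT).
apply (under_mp HT _ (FSim X)); hyp HT.
Qed.

Lemma imp_sim_cap X Y : T ((X ⊃ Y) ⊃ FSim (FCap X (FSim Y))).
Proof.
repeat discharge.
apply (under_mp HT _ Y).
- apply (under_cap_right HT _ X); hyp HT.
- apply (under_mp HT _ X); [hyp HT|].
  apply (under_cap_left HT _ _ (FSim Y)); hyp HT.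
Qed.

Lemma sim_cap_imp X Y : T (FSim (FCap X (FSim Y)) ⊃ (X ⊃ Y)).
Proof.
repeat discharge; apply (under_contradiction HT), (under_absurd HT).
apply (under_mp HT _ (FCap X (FSim Y))); [hyp HT|].
apply (under_cap HT); hyp HT.
Qed.

(** The axiom [Ax7] speaks of [+]; passing to [-] costs a contraposition,
    which is classical because [+X] is [∼-X]. *)
Lemma neg_anti X Y : T (FPlus (X ⊃ Y)) -> T (- Y ⊃ - X).
Proof.
intros H; repeat discharge.
apply (under_contradiction HT), (under_absurd HT).
apply (under_mp HT _ (- Y)); [|hyp HT].
apply (under_mp HT _ (FPlus X)); [|hyp HT].
apply (under_theorem HT), (proj2 HT (FPlus (X ⊃ Y))); [|exact H].
apply (proj1 HT), Ax7.
Qed.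

End Order.

(** * Necessitation *)

Section Necessitation.
Context {FA : Type}.
Implicit Types (X Y : formula FA) (Gamma : formula FA -> Prop).

Lemma derivable_theory Gamma : theory (gt4_derivable Gamma).
Proof.
split; [|exact (@d_mp _ Gamma)].
intros X HX; now apply d_ax, AxBase, gt4_of_gt.
Qed.

(** Since the axioms include [+A] for every schema [A], propositional theorems
    are available under [+]; [Ax7] is closure under modus ponens. *)
Lemma plus_theory Gamma : theory (fun X => gt4_derivable Gamma (FPlus X)).
Proof.
split.
- intros X HX; now apply d_ax, AxPlus, gt4_of_gt.
- intros X Y HXY HX; apply (d_mp (X := FPlus X)); [|exact HX].
  apply (d_mp (X := FPlus (X ⊃ Y))); [|exact HXY].
  apply d_ax, AxBase, gt4_of_gt, Ax7.
Qed.

(** From [+X] the strong axiom with [Y := λ] gives [+(+X ∩ λ)]: its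
    conclusion [-(+X ∩ λ) ⊃ -λ] is just that. What remains is to pass from
    [+X ∩ λ] to [+X] under [+]. *)
Lemma plus_plus Gamma X :
  gt4_derivable Gamma (FPlus X) -> gt4_derivable Gamma (FPlus (FPlus X)).
Proof.
intros H; set (T := fun Y => gt4_derivable Gamma (FPlus Y)).
change (T (FPlus X)).
apply (proj2 (plus_theory Gamma) (FCap (FPlus X) λ)).
- exact (cap_left (plus_theory Gamma) (FPlus X) λ).
- apply (d_mp (X := FPlus X)); [|exact H].
  apply d_ax, AxBase, Ax_strong.
Qed.

(** The base axioms have their [+] as an axiom. For the axioms [+A] themselves
    this is [plus_plus]. *)
Lemma necessitation Gamma X :
  (forall Z, Gamma Z -> gt4_derivable Gamma (FPlus Z)) ->
  gt4_derivable Gamma X -> gt4_derivable Gamma (FPlus X).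
Proof.
intros HG; induction 1 as [X HX|X HX|X Y _ IH1 _ IH2].
- now apply HG.
- destruct HX as [X HX|X HX]; [now apply d_ax, AxPlus|].
  now apply plus_plus, d_ax, AxPlus.
- exact (proj2 (plus_theory Gamma) X Y IH1 IH2).
Qed.

Lemma TT4_theory : theory (@TT4 FA).
Proof. exact (derivable_theory _). Qed.

Lemma TT4_neg_anti X Y : TT4 (X ⊃ Y) -> TT4 (- Y ⊃ - X).
Proof.
intros H; apply (neg_anti TT4_theory), necessitation; [easy | exact H].
Qed.

Lemma derivable_cut Gamma Delta X :
  (forall Z, Gamma Z -> gt4_derivable Delta Z) ->
  gt4_derivable Gamma X -> gt4_derivable Delta X.
Proof.
intros H; induction 1 as [X HX|X HX|X Y _ IH1 _ IH2].
- now apply H.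
- now apply d_ax.
- exact (d_mp IH1 IH2).
Qed.

Lemma consequence_imp X Y : gt4_consequence X Y <-> TT4 (X ⊃ Y).
Proof.
split.
- induction 1 as [Z ->|Z HZ|Z Z' _ IH1 _ IH2].
  + apply (imp_refl TT4_theory).
  + now apply (imp_of_theorem TT4_theory), d_ax.
  + exact (under_mp TT4_theory [X] Z Z' IH1 IH2).
- intros H; apply (d_mp (X := X)); [|now apply d_hyp].
  now apply (derivable_cut (fun _ => False)).
Qed.

Lemma consequence_lam X : gt4_consequence λ X <-> TT4 X.
Proof.
rewrite consequence_imp; split; intros H.
- apply (d_mp H), d_ax, AxBase, gt4_of_gt, Ax1.
- now apply (imp_of_theorem TT4_theory).
Qed.

Definition equivalent X Y : Prop := TT4 (X ⊃ Y) /\ TT4 (Y ⊃ X).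

Lemma equivalent_refl X : equivalent X X.
Proof. split; apply (imp_refl TT4_theory). Qed.

Lemma equivalent_sym X Y : equivalent X Y -> equivalent Y X.
Proof. intros [H1 H2]; now split. Qed.

Lemma equivalent_trans X Y Z :
  equivalent X Y -> equivalent Y Z -> equivalent X Z.
Proof.
intros [H1 H2] [H3 H4]; split; eapply (imp_trans TT4_theory); eassumption.
Qed.

Lemma equivalent_neg X Y : equivalent X Y -> equivalent (- X) (- Y).
Proof. intros [H1 H2]; split; now apply TT4_neg_anti. Qed.

Lemma equivalent_imp X X' Y Y' :
  equivalent X X' -> equivalent Y Y' -> equivalent (X ⊃ Y) (X' ⊃ Y').
Proof. intros [H1 H2] [H3 H4]; split; now apply (imp_mono TT4_theory). Qed.

Lemma equivalent_cap X X' Y Y' :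
  equivalent X X' -> equivalent Y Y' -> equivalent (FCap X Y) (FCap X' Y').
Proof. intros [H1 H2] [H3 H4]; split; now apply (cap_mono TT4_theory). Qed.

Lemma equivalent_sim X Y : equivalent X Y -> equivalent (FSim X) (FSim Y).
Proof. intros H; apply equivalent_imp; [exact H | apply equivalent_refl]. Qed.

Lemma equivalent_sim_cap X Y : equivalent (FSim (FCap X (FSim Y))) (X ⊃ Y).
Proof.
split; [apply (sim_cap_imp TT4_theory) | apply (imp_sim_cap TT4_theory)].
Qed.

Lemma equivalent_consequence X X' Y Y' :
  equivalent X X' -> equivalent Y Y' ->
  (gt4_consequence X Y <-> gt4_consequence X' Y').
Proof.
intros [H1 H2] [H3 H4]; rewrite !consequence_imp; split; intros H;
  apply (d_mp (X := _ ⊃ _)) with (2 := H); now apply (imp_mono TT4_theory).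
Qed.

End Necessitation.

(** * The plain reading of a graph *)

Section Readings.
Context {FA : Type}.
Implicit Types G H : graph FA.

(** The translation without the special clauses for [(X(Y))] and [((X)(Y))],
    which makes it compositional: the reading of a filled region depends only
    on the reading of what fills it. *)
Fixpoint plain (G : graph FA) : formula FA :=
  match G with
  | GAtom p => FAtom p
  | GBlank => λ
  | GJuxt X Y => FCap (plain X) (plain Y)
  | GCut X => FSim (plain X)
  | GBroken X => - plain X
  end.

(** [to_formula] looks three constructors deep, so the argument for a cut around
    [X(Y)] or [(X)(Y)] is recursive in the contents of the inner cuts, which are
    not immediate parts of the graph. *)
Lemma to_formula_cut G :
  equivalent (to_formula (GCut G)) (FSim (to_formula G)).
Proof.
revert G; fix IH 1; intros [p| |X Y|X|X]; try apply equivalent_refl.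
destruct Y as [p| |Y Y'|Y|Y];
  try (destruct X; apply equivalent_refl).
assert (HY : forall A,
  equivalent (A ⊃ to_formula Y) (FSim (FCap A (to_formula (GCut Y))))).
{ intros A; eapply equivalent_trans;
    [apply equivalent_sym, equivalent_sim_cap|].
  apply equivalent_sim, equivalent_cap;
    [apply equivalent_refl | apply equivalent_sym, IH]. }
destruct X as [p| |X X'|X|X]; try apply HY.
eapply equivalent_trans; [|apply HY].
apply equivalent_imp; [apply equivalent_sym, IH | apply equivalent_refl].
Qed.

Lemma to_formula_plain G : equivalent (to_formula G) (plain G).
Proof.
induction G as [p| |X IHX Y IHY|X IH|X IH]; try apply equivalent_refl.
- now apply equivalent_cap.
- eapply equivalent_trans; [apply to_formula_cut | now apply equivalent_sim].
- now apply equivalent_neg.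
Qed.

Lemma unabbreviate_plain (X : wformula FA) :
  equivalent (unabbreviate X) (plain (to_graph X)).
Proof.
induction X as [p| |X IH|X IHX Y IHY|X IH|X IHX Y IHY|X IHX Y IHY];
  simpl; try apply equivalent_refl.
- now apply equivalent_neg.
- eapply equivalent_trans;
    [now apply equivalent_imp; eassumption|].
  apply equivalent_sym, equivalent_sim_cap.
- now apply equivalent_sim.
- now apply equivalent_cap.
- eapply equivalent_trans;
    [apply equivalent_imp; [apply equivalent_sim|]; eassumption|].
  apply equivalent_sym, equivalent_sim_cap.
Qed.

End Readings.

(** * Soundness of the transformations *)

Section Soundness.
Context {FA : Type}.
Implicit Types (X Y : graph FA) (C D : region FA).

(** Each cut reverses the direction. A broken cut needs the implication under
    [+] in order to be reversed, hence closure of [T] under [+]. *)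
Lemma fill_mono (T : formula FA -> Prop) C X Y :
  theory T ->
  broken_cuts C = 0 \/ (forall Z, T Z -> T (FPlus Z)) ->
  T (plain X ⊃ plain Y) ->
  (even_region C -> T (plain (fill C X) ⊃ plain (fill C Y))) /\
  (odd_region C -> T (plain (fill C Y) ⊃ plain (fill C X))).
Proof.
intros HT HC HXY; unfold even_region, odd_region.
induction C as [|C IH Z|Z C IH|C IH|C IH]; simpl in *.
- split; [easy|]; intros HO; now apply Nat.odd_spec in HO.
- destruct (IH HC) as [IH1 IH2]; split; intros HP;
    apply (cap_mono HT); try apply (imp_refl HT); auto.
- destruct (IH HC) as [IH1 IH2]; split; intros HP;
    apply (cap_mono HT); try apply (imp_refl HT); auto.
- rewrite Nat.Even_succ, Nat.Odd_succ.
  destruct (IH HC) as [IH1 IH2]; split; intros HP;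
    apply (sim_anti HT); auto.
- rewrite Nat.Even_succ, Nat.Odd_succ.
  destruct HC as [HC|HC]; [easy|].
  destruct (IH (or_intror HC)) as [IH1 IH2]; split; intros HP;
    apply (neg_anti HT), HC; auto.
Qed.

Lemma fill_equivalent (T : formula FA -> Prop) C X Y :
  theory T ->
  broken_cuts C = 0 \/ (forall Z, T Z -> T (FPlus Z)) ->
  T (plain X ⊃ plain Y) -> T (plain Y ⊃ plain X) ->
  T (plain (fill C X) ⊃ plain (fill C Y)).
Proof.
intros HT HC HXY HYX.
destruct (Nat.Even_or_Odd (cuts C)) as [HP|HP].
- now apply (fill_mono T C X Y HT HC HXY).
- now apply (fill_mono T C Y X HT HC HYX).
Qed.

Lemma consequence_iteration (W : formula FA) A B :
  gt4_consequence W (A ⊃ B) -> TT4 (FCap W A ⊃ FCap W B).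
Proof.
intros H; apply consequence_imp in H.
apply (imp_cap TT4_theory); [apply (cap_left TT4_theory)|].
apply (under_mp TT4_theory [FCap W A] A B);
  [|apply (cap_right TT4_theory)].
apply (under_mp TT4_theory [FCap W A] W); [|apply (cap_left TT4_theory)].
now apply (under_theorem TT4_theory).
Qed.

(** Among the consequences of [Y], the graphs [X] and [Z] are interchangeable.
    So they are in the region [D], either because no broken cut is crossed or
    because those consequences are closed under [+]. *)
Lemma iteration_sound D X Y Z :
  broken_cuts D = 0 \/
    gt4_consequence (plain Y) (FPlus (plain Y)) ->
  (forall T, theory T -> T (plain Y) -> T (plain X ⊃ plain Z)) ->
  (forall T, theory T -> T (plain Y) -> T (plain Z ⊃ plain X)) ->
  equivalent (plain (GJuxt Y (fill D X))) (plain (GJuxt Y (fill D Z))).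
Proof.
intros HD H1 H2.
assert (HT : theory (gt4_consequence (plain Y))) by apply derivable_theory.
assert (HY : gt4_consequence (plain Y) (plain Y)) by now apply d_hyp.
assert (HN : broken_cuts D = 0 \/
  (forall Z, gt4_consequence (plain Y) Z ->
             gt4_consequence (plain Y) (FPlus Z))).
{ destruct HD as [HD|HD]; [now left|right].
  intros A; apply necessitation; now intros _ ->. }
specialize (H1 _ HT HY); specialize (H2 _ HT HY).
split; apply consequence_iteration, (fill_equivalent _ D); assumption.
Qed.

Lemma cap_known (T : formula FA -> Prop) (W A : formula FA) :
  theory T -> T W ->
  (T (A ⊃ FCap A W) /\ T (FCap A W ⊃ A)) /\
  (T (A ⊃ FCap W A) /\ T (FCap W A ⊃ A)).
Proof.
intros HT HW; repeat split.
- now apply (imp_cap HT); [apply (imp_refl HT) | apply (imp_of_theorem HT)].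
- apply (cap_left HT).
- now apply (imp_cap HT); [apply (imp_of_theorem HT) | apply (imp_refl HT)].
- apply (cap_right HT).
Qed.

Lemma R3_iter_sound D X Y :
  broken_cuts D = 0 ->
  equivalent (plain (GJuxt Y (fill D X)))
             (plain (GJuxt Y (fill D (GJuxt X Y)))).
Proof.
intros HD; apply iteration_sound; [now left| |];
  intros T HT HY; apply (cap_known T); auto.
Qed.

Lemma strong_iter_sound D X Y :
  equivalent (plain (GJuxt (GStrong Y) (fill D X)))
             (plain (GJuxt (GStrong Y) (fill D (GJuxt (GStrong Y) X)))).
Proof.
apply iteration_sound.
- right; now apply plus_plus, d_hyp.
- intros T HT HY; apply (cap_known T); auto.
- intros T HT HY; apply (cap_known T); auto.
Qed.

Lemma equiv_sound C X Y : get_equiv C X Y -> equivalent (plain X) (plain Y).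
Proof.
pose proof (@TT4_theory FA) as HT.
intros [D X' Y' HD|X'|X' Y' _|X' Y'|X' Y' Z'|X'].
- now apply R3_iter_sound.
- split; [apply (imp_cap HT); apply (imp_refl HT) | apply (cap_left HT)].
- now apply (R3_iter_sound (RCut RHere)).
- split; apply (imp_cap HT); apply (cap_left HT) || apply (cap_right HT).
- pose proof (imp_trans HT) as trans.
  pose proof (cap_left HT) as left; pose proof (cap_right HT) as right.
  split; simpl; repeat apply (imp_cap HT); eauto.
- split; [apply (cap_right HT) | apply (imp_cap HT)].
  + apply (imp_of_theorem HT), (proj1 HT), Ax1.
  + apply (imp_refl HT).
Qed.

(** A rule performed in an odd region is justified by the converse
    implication. *)
Lemma rule_sound C X Y :
  get4_rule C X Y ->
  even_region C /\ TT4 (plain X ⊃ plain Y) \/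
  odd_region C /\ TT4 (plain Y ⊃ plain X).
Proof.
pose proof (@TT4_theory FA) as HT.
assert (parity : forall A B : formula FA, equivalent A B ->
  even_region C /\ TT4 (A ⊃ B) \/ odd_region C /\ TT4 (B ⊃ A)).
{ intros A B [H1 H2].
  destruct (Nat.Even_or_Odd (cuts C)); [now left | now right]. }
intros [X' Y' HR|D X' Y' _|D X' Y' _].
- destruct HR as [H0|X' Y' HC|X' Y' HC|X' HC|X' HC|X' HC|X' HC
                 |X' Y' HR|X' Y' HR].
  + left; split; [exists 0; exact H0|].
    apply (imp_of_theorem HT), (imp_refl HT).
  + left; split; [exact HC | apply (cap_left HT)].
  + right; split; [exact HC | apply (cap_left HT)].
  + left; split; [exact HC | apply (proj1 HT), Ax6].
  + right; split; [exact HC | apply (proj1 HT), Ax6].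
  + left; split; [exact HC | apply (sim_sim_elim HT)].
  + right; split; [exact HC | apply (sim_sim_elim HT)].
  + now apply parity, (equiv_sound C).
  + now apply parity, equivalent_sym, (equiv_sound C).
- apply parity, strong_iter_sound.
- apply parity, equivalent_sym, strong_iter_sound.
Qed.

Lemma gives_sound X Y :
  get4_gives X Y -> gt4_consequence (plain X) (plain Y).
Proof.
pose proof (@TT4_theory FA) as HT.
rewrite consequence_imp; induction 1 as [X Y HXY|X|X Y Z _ IH1 _ IH2].
- destruct HXY as [C X Y HXY].
  assert (HN : broken_cuts C = 0 \/
    (forall Z, TT4 Z -> TT4 (@FPlus FA Z))).
  { right; intros Z; now apply necessitation. }
  destruct (rule_sound C X Y HXY) as [[HP H]|[HP H]].
  + now apply (fill_mono _ C X Y HT HN H).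
  + now apply (fill_mono _ C Y X HT HN H).
- apply (imp_refl HT).
- exact (imp_trans HT _ _ _ IH1 IH2).
Qed.

End Soundness.

(** * Entailment between graphs in every region *)

Section Entailment.
Context {GA : Type}.
Implicit Types (X Y Z : graph GA) (C D : region GA).

(** The region [D] taken inside the region [C]. *)
Fixpoint within C D : region GA :=
  match C with
  | RHere => D
  | RJuxtL C Y => RJuxtL (within C D) Y
  | RJuxtR Y C => RJuxtR Y (within C D)
  | RCut C => RCut (within C D)
  | RBroken C => RBroken (within C D)
  end.

Lemma fill_within C D X : fill (within C D) X = fill C (fill D X).
Proof. induction C; simpl; congruence. Qed.

Lemma cuts_within C D : cuts (within C D) = cuts C + cuts D.
Proof. induction C; simpl; congruence. Qed.

(** Requiring the transformation in every region, in the direction fixed by the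
    parity, is what makes cuts antitone for this preorder. *)
Definition entails X Y : Prop :=
  (forall C, even_region C -> get4_gives (fill C X) (fill C Y)) /\
  (forall C, odd_region C -> get4_gives (fill C Y) (fill C X)).

#[local] Instance entails_preorder : PreOrder entails.
Proof.
split.
- intros X; split; intros C _; apply rt_refl.
- intros X Y Z [H1 H2] [H3 H4]; split; intros C HC;
    apply rt_trans with (fill C Y); [apply H1|apply H3|apply H4|apply H2];
    exact HC.
Qed.

Lemma entails_fill_even D X Y :
  even_region D -> entails X Y -> entails (fill D X) (fill D Y).
Proof.
unfold even_region; intros HD [H1 H2].
split; intros C HC; rewrite <- !fill_within; [apply H1 | apply H2];
  unfold even_region, odd_region in *; rewrite cuts_within.
- now apply Nat.Even_Even_add.
- now apply Nat.Odd_add_l.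
Qed.

Lemma entails_fill_odd D X Y :
  odd_region D -> entails X Y -> entails (fill D Y) (fill D X).
Proof.
unfold odd_region; intros HD [H1 H2].
split; intros C HC; rewrite <- !fill_within; [apply H2 | apply H1];
  unfold even_region, odd_region in *; rewrite cuts_within.
- now apply Nat.Odd_add_r.
- now apply Nat.Odd_Odd_add.
Qed.

#[local] Instance entails_juxt :
  Proper (entails ==> entails ==> entails) (@GJuxt GA).
Proof.
intros X X' HX Y Y' HY; transitivity (GJuxt X' Y).
- apply (entails_fill_even (RJuxtL RHere Y)); [now exists 0 | exact HX].
- apply (entails_fill_even (RJuxtR X' RHere)); [now exists 0 | exact HY].
Qed.

#[local] Instance entails_cut : Proper (entails --> entails) (@GCut GA).
Proof.
intros X Y H; apply (entails_fill_odd (RCut RHere)); [now exists 0 | exact H].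
Qed.

#[local] Instance entails_broken : Proper (entails --> entails) (@GBroken GA).
Proof.
intros X Y H; apply (entails_fill_odd (RBroken RHere));
  [now exists 0 | exact H].
Qed.

Lemma gives_at C X Y : get4_rule C X Y -> get4_gives (fill C X) (fill C Y).
Proof. intros H; now apply rt_step, get4_at. Qed.

Lemma entails_of_equiv X Y :
  (forall C, get_equiv C X Y) -> entails X Y /\ entails Y X.
Proof.
intros H; split; split; intros C _; apply gives_at, get4_of_get;
  (now apply R_equiv) || (now apply R_equiv_sym).
Qed.

Lemma juxt_comm X Y : entails (GJuxt X Y) (GJuxt Y X).
Proof. refine (proj1 (entails_of_equiv _ _ _)); constructor. Qed.

Lemma juxt_dup X : entails X (GJuxt X X).
Proof. refine (proj1 (entails_of_equiv _ _ _)); constructor. Qed.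

Lemma blank_juxt X : entails X (GJuxt GBlank X).
Proof. refine (proj2 (entails_of_equiv _ _ _)); constructor. Qed.

Lemma iterate D X Y :
  broken_cuts D = 0 ->
  entails (GJuxt Y (fill D X)) (GJuxt Y (fill D (GJuxt X Y))).
Proof. intros HD; refine (proj1 (entails_of_equiv _ _ _)); now constructor. Qed.

Lemma deiterate D X Y :
  broken_cuts D = 0 ->
  entails (GJuxt Y (fill D (GJuxt X Y))) (GJuxt Y (fill D X)).
Proof. intros HD; refine (proj2 (entails_of_equiv _ _ _)); now constructor. Qed.

Lemma strong_iterate D X Y :
  0 < broken_cuts D ->
  entails (GJuxt (GStrong Y) (fill D X))
          (GJuxt (GStrong Y) (fill D (GJuxt (GStrong Y) X))).
Proof.
intros HD; split; intros C _; apply gives_at;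
  [now apply strong_iter | now apply strong_deiter].
Qed.

Lemma strong_deiterate D X Y :
  0 < broken_cuts D ->
  entails (GJuxt (GStrong Y) (fill D (GJuxt (GStrong Y) X)))
          (GJuxt (GStrong Y) (fill D X)).
Proof.
intros HD; split; intros C _; apply gives_at;
  [now apply strong_deiter | now apply strong_iter].
Qed.

Lemma juxt_left X Y : entails (GJuxt X Y) X.
Proof. split; intros C HC; apply gives_at, get4_of_get; now constructor. Qed.

Lemma juxt_right X Y : entails (GJuxt X Y) Y.
Proof. rewrite juxt_comm; apply juxt_left. Qed.

Lemma juxt_intro X Y Z : entails Z X -> entails Z Y -> entails Z (GJuxt X Y).
Proof. intros HX HY; rewrite <- HX, <- HY; apply juxt_dup. Qed.

Lemma entails_blank X : entails X GBlank.
Proof. rewrite (blank_juxt X); apply juxt_left. Qed.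

Lemma cut_broken X : entails (GCut X) (GBroken X).
Proof. split; intros C HC; apply gives_at, get4_of_get; now constructor. Qed.

Lemma double_cut_elim X : entails (GCut (GCut X)) X.
Proof. split; intros C HC; apply gives_at, get4_of_get; now constructor. Qed.

Lemma gives_of_entails X Y : entails X Y -> get4_gives X Y.
Proof. intros [H _]; apply (H RHere); now exists 0. Qed.

(** The rule that writes [({λ})] works on the sheet alone, but once there the
    mark can be iterated into any region, by the ordinary rule or by the strong
    one according to the cuts in between, and the original erased. *)
Lemma strong_blank : entails GBlank (GStrong GBlank).
Proof.
set (S := GStrong GBlank).
assert (HR1 : forall X, get4_gives X (GJuxt S X)).
{ intros X; eapply rt_trans; [apply gives_of_entails, (blank_juxt X)|].
  apply (gives_at (RJuxtL RHere X)), get4_of_get; now apply R1. }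
assert (HS : forall C, get4_gives (fill C GBlank) (fill C S) /\
                       get4_gives (fill C S) (fill C GBlank)).
{ intros C.
  assert (HC : entails (GJuxt S (fill C GBlank)) (GJuxt S (fill C S)) /\
               entails (GJuxt S (fill C S)) (GJuxt S (fill C GBlank))).
  { assert (Hfill : forall X Y, entails X Y -> entails Y X ->
      entails (fill C X) (fill C Y)).
    { intros X Y H1 H2; destruct (Nat.Even_or_Odd (cuts C)).
      - now apply entails_fill_even.
      - now apply entails_fill_odd. }
    destruct (Nat.eq_0_gt_0_cases (broken_cuts C)) as [H0|H0]; split.
    - rewrite (iterate C GBlank S H0); apply entails_juxt; [reflexivity|].
      apply Hfill; [apply juxt_right | apply blank_juxt].
    - rewrite <- (deiterate C GBlank S H0).
      apply entails_juxt; [reflexivity|].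
      apply Hfill; [apply blank_juxt | apply juxt_right].
    - etransitivity; [exact (strong_iterate C GBlank GBlank H0)|].
      apply entails_juxt; [reflexivity|].
      apply Hfill; [apply juxt_left|].
      rewrite <- juxt_comm; apply blank_juxt.
    - etransitivity; [|exact (strong_deiterate C GBlank GBlank H0)].
      apply entails_juxt; [reflexivity|].
      apply Hfill; [rewrite <- juxt_comm; apply blank_juxt|].
      apply juxt_left. }
  destruct HC as [HC1 HC2].
  split; (eapply rt_trans; [apply HR1|]); apply gives_of_entails.
  - rewrite HC1; apply juxt_right.
  - rewrite HC2; apply juxt_right. }
split; intros C _; apply HS.
Qed.

Lemma double_cut_blank : entails GBlank (GCut (GCut GBlank)).
Proof. rewrite strong_blank at 1; unfold GStrong; now rewrite <- cut_broken. Qed.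

Lemma cut_deiterate X Y :
  entails (GJuxt Y (GCut (GJuxt X Y))) (GJuxt Y (GCut X)).
Proof. now apply (deiterate (RCut RHere)). Qed.

(** [((λ))] may be written beside [X], and [X] iterated into it. *)
Lemma double_cut_intro X : entails X (GCut (GCut X)).
Proof.
transitivity (GJuxt X (GCut (GCut GBlank))).
- apply juxt_intro; [reflexivity|].
  rewrite (entails_blank X); apply double_cut_blank.
- transitivity (GJuxt X (GCut (GCut (GJuxt GBlank X)))).
  + now apply (iterate (RCut (RCut RHere))).
  + now rewrite !juxt_right.
Qed.

(** De-iterating [X] empties the cut. *)
Lemma contradiction X : entails (GJuxt X (GCut X)) (GCut GBlank).
Proof.
rewrite <- (juxt_right GBlank X) at 2.
now rewrite cut_deiterate, juxt_right.
Qed.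

Lemma self_scroll X : entails GBlank (GCut (GJuxt X (GCut X))).
Proof. rewrite (contradiction X); apply double_cut_blank. Qed.

(** [(X(Y))] is the relative pseudo-complement for juxtaposition: with it and
    the double cut, entailment makes the graphs a Boolean algebra. *)
Lemma scroll_intro X Y Z :
  entails (GJuxt Z X) Y -> entails Z (GCut (GJuxt X (GCut Y))).
Proof.
intros H; transitivity (GJuxt Z (GCut (GJuxt X (GCut X)))).
- apply juxt_intro; [reflexivity|].
  rewrite (entails_blank Z); apply self_scroll.
- etransitivity;
    [now apply (iterate (RCut (RJuxtR X (RCut RHere))) X Z)|]; simpl.
  now rewrite (juxt_comm X Z), H, juxt_right.
Qed.

Lemma scroll_elim X Y Z :
  entails Z (GCut (GJuxt X (GCut Y))) -> entails Z X -> entails Z Y.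
Proof.
intros H HX; rewrite (juxt_intro _ _ _ HX H).
rewrite <- (juxt_comm (GCut Y) X), cut_deiterate, juxt_right.
apply double_cut_elim.
Qed.

Lemma cut_blank_elim X : entails (GCut GBlank) X.
Proof.
rewrite <- (double_cut_elim X) at 1.
now rewrite (entails_blank (GCut X)).
Qed.

Lemma broken_blank_elim X : entails (GBroken GBlank) X.
Proof.
rewrite <- (cut_blank_elim X), <- (contradiction (GBroken GBlank)).
apply juxt_intro; [reflexivity|].
etransitivity; [apply entails_blank | apply strong_blank].
Qed.

Lemma strong_elim X : entails (GStrong X) X.
Proof. unfold GStrong; rewrite <- cut_broken; apply double_cut_elim. Qed.

Lemma scroll_broken_blank X :
  entails (GCut X) (GCut (GJuxt X (GCut (GBroken GBlank)))) /\
  entails (GCut (GJuxt X (GCut (GBroken GBlank)))) (GCut X).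
Proof.
split; apply entails_cut; red; [apply juxt_left|].
apply juxt_intro; [reflexivity|].
rewrite (entails_blank X); apply strong_blank.
Qed.

(** Classical argument by contradiction: together with [(X)], which entails
    [(X(Y))], the hypothesis gives [X] and thus the absurd [(λ)]. *)
Lemma peirce X Y Z :
  entails Z (GCut (GJuxt (GCut (GJuxt X (GCut Y))) (GCut X))) -> entails Z X.
Proof.
intros H; rewrite <- (double_cut_elim X).
assert (HX : entails (GJuxt Z (GCut X)) X).
{ apply (scroll_elim (GCut (GJuxt X (GCut Y))));
    [now rewrite juxt_left|].
  rewrite juxt_right; apply entails_cut; red; apply juxt_left. }
rewrite <- (proj2 (scroll_broken_blank (GCut X))).
apply scroll_intro.
rewrite <- (cut_blank_elim (GBroken GBlank)).
rewrite (juxt_intro _ _ _ HX (juxt_right Z (GCut X))).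
apply contradiction.
Qed.

(** The graph form of the modal axiom K. It uses strong iteration: [({X})] is
    carried into [({Y})], where it yields [X] beside [Y]. *)
Lemma strong_mp X Y Z :
  entails (GJuxt X Y) Z ->
  entails (GJuxt (GStrong X) (GStrong Y)) (GStrong Z).
Proof.
intros H.
rewrite (strong_iterate (RCut (RBroken RHere)) Y X) by (simpl; auto); simpl.
now rewrite (strong_elim X), H, juxt_right.
Qed.

End Entailment.

(** * Completeness of the transformations *)

Section Completeness.
Context {FA : Type}.
Implicit Types (X Y : formula FA) (G H Z : graph FA).

#[local] Existing Instances
  entails_preorder entails_juxt entails_cut entails_broken.

Fixpoint scribe (X : formula FA) : graph FA :=
  match X with
  | FAtom p => GAtom p
  | FLam => GBlank
  | FNeg X => GBroken (scribe X)
  | FImp X Y => GCut (GJuxt (scribe X) (GCut (scribe Y)))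
  end.

(** In [∼X = X ⊃ -λ] the graph of [-λ] sits in a cut, and [({λ})] may be
    erased. *)
Lemma scribe_sim X :
  entails (scribe (FSim X)) (GCut (scribe X)) /\
  entails (GCut (scribe X)) (scribe (FSim X)).
Proof. split; apply (scroll_broken_blank (scribe X)). Qed.

Lemma scribe_cap X Y :
  entails (scribe (FCap X Y)) (GJuxt (scribe X) (scribe Y)) /\
  entails (GJuxt (scribe X) (scribe Y)) (scribe (FCap X Y)).
Proof.
destruct (scribe_sim (X ⊃ FSim Y)) as [H1 H2].
destruct (scribe_sim Y) as [H3 H4].
change (scribe (X ⊃ FSim Y))
  with (GCut (GJuxt (scribe X) (GCut (scribe (FSim Y))))) in H1, H2.
unfold FCap; split.
- now rewrite H1, double_cut_elim, <- H4, double_cut_elim.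
- now rewrite <- H2, <- double_cut_intro, H3, <- double_cut_intro.
Qed.

Lemma scribe_plain G :
  entails (scribe (plain G)) G /\ entails G (scribe (plain G)).
Proof.
induction G as [p| |X [X1 X2] Y [Y1 Y2]|X [X1 X2]|X [X1 X2]]; simpl plain.
- now split.
- now split.
- destruct (scribe_cap (plain X) (plain Y)) as [H1 H2].
  split; [now rewrite H1, X1, Y1 | now rewrite <- H2, <- X2, <- Y2].
- destruct (scribe_sim (plain X)) as [H1 H2].
  split; [now rewrite H1, <- X2 | now rewrite <- H2, X1].
- simpl; split; [now rewrite <- X2 | now rewrite X1].
Qed.

(** In the modal case [Ax7] is [strong_mp], and the strong axiom is strong
    de-iteration out of a single broken cut. *)
Lemma schema_valid X : gt4_schema X -> entails GBlank (scribe X).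
Proof.
intros [A HA|A B].
- destruct HA as [|A B|A B C|A B|A|A|A B]; simpl.
  + reflexivity.
  + do 2 apply scroll_intro; now rewrite juxt_left, juxt_right.
  + do 3 apply scroll_intro; set (Z := GJuxt _ (scribe A)).
    assert (HZ : entails Z (scribe A)) by apply juxt_right.
    apply (scroll_elim (scribe B)).
    * apply (scroll_elim (scribe A)); [|exact HZ].
      unfold Z; now rewrite juxt_left, juxt_left, juxt_right.
    * apply (scroll_elim (scribe A)); [|exact HZ].
      unfold Z; now rewrite juxt_left, juxt_right.
  + apply scroll_intro, (peirce _ (scribe B)), juxt_right.
  + apply scroll_intro; rewrite juxt_right; apply broken_blank_elim.
  + apply scroll_intro; rewrite juxt_right.
    rewrite (proj2 (scroll_broken_blank _)); apply cut_broken.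
  + do 2 apply scroll_intro.
    rewrite !(proj2 (scroll_broken_blank _)), (juxt_right GBlank).
    rewrite <- (proj1 (scroll_broken_blank _)).
    apply strong_mp, (scroll_elim (scribe A));
      [apply juxt_left | apply juxt_right].
- destruct (scribe_sim (- A)) as [H1 H2].
  change (entails GBlank
    (GCut (GJuxt (scribe (FPlus A))
      (GCut (GCut (GJuxt (GBroken (scribe (FCap (FPlus A) B)))
        (GCut (GBroken (scribe B))))))))).
  do 2 apply scroll_intro.
  rewrite (juxt_right GBlank), <- (proj2 (scribe_cap _ _)).
  transitivity (GJuxt (GStrong (scribe A))
    (GBroken (GJuxt (GStrong (scribe A)) (scribe B)))).
  + apply entails_juxt; [exact H1|].
    apply entails_broken, entails_juxt; [exact H2 | reflexivity].
  + etransitivity; [apply (strong_deiterate (RBroken RHere)); simpl; auto|].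
    apply juxt_right.
Qed.

(** An axiom [A] entailed by the blank makes [{A}] entail [{λ}]. *)
Lemma axiom_valid X : gt4_axiom X -> entails GBlank (scribe X).
Proof.
intros [A HA|A HA]; [now apply schema_valid|].
simpl; apply scroll_intro.
rewrite juxt_right; now rewrite <- (schema_valid A HA).
Qed.

Lemma consequence_valid X Y :
  gt4_consequence X Y -> entails (scribe X) (scribe Y).
Proof.
induction 1 as [Z ->|Z HZ|Z Z' _ IH1 _ IH2].
- reflexivity.
- rewrite entails_blank; now apply axiom_valid.
- now apply (scroll_elim (scribe Z)).
Qed.

Lemma gives_complete G H :
  gt4_consequence (plain G) (plain H) -> get4_gives G H.
Proof.
intros HGH; apply gives_of_entails.
rewrite (proj2 (scribe_plain G)), <- (proj1 (scribe_plain H)).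
now apply consequence_valid.
Qed.

End Completeness.

Theorem mainTheorem4 (FA : Type) (G H : graph FA) (X Y : wformula FA) :
  (TGET4 G <-> TT4 (to_formula G)) /\
  (TGET4 (to_graph X) <-> TT4 (unabbreviate X)) /\
  (get4_gives G H <-> gt4_consequence (to_formula G) (to_formula H)) /\
  (get4_gives (to_graph X) (to_graph Y) <->
   gt4_consequence (unabbreviate X) (unabbreviate Y)).
Proof.
assert (main : forall (G H : graph FA) (A B : formula FA),
  equivalent A (plain G) -> equivalent B (plain H) ->
  (get4_gives G H <-> gt4_consequence A B)).
{ intros G' H' A B HA HB; rewrite (equivalent_consequence _ _ _ _ HA HB).
  split; [apply gives_sound | apply gives_complete]. }
unfold TGET4; rewrite <- !consequence_lam.
repeat split; apply main;
  auto using equivalent_refl, to_formula_plain, unabbreviate_plain.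
Qed.
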